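(* Fix $p\in(1,2]$, $r>0$ and a linear objective $c\in\mathbb{R}^n$. Let $x\in\mathbb{R}^n$ be such that $x_i=-\frac{r}{\|c\|_q^{q-1}}\,\mathrm{sgn}(c_i)\,|c_i|^{q-1}$, where $q$ satisfies $\frac1q+\frac1p=1$. Then $x=\arg\min_{y\in\mathbb{B}_p(r)}y\cdot c$, where $\mathbb{B}_p(r)=\{y\in\mathbb{R}^n:\|y\|_p\le r\}$.
   Context: For $a\ge 1$ and $v\in\mathbb{R}^n$, $\|v\|_a=\left(\sum_{i=1}^n|v_i|^a\right)^{1/a}$; $y\cdot c=\sum_{i=1}^n y_ic_i$; and $\mathrm{sgn}(\cdot)$ is the sign function. *)

(* Defs.v *)
From mathcomp Require Import all_boot all_order all_algebra.
From mathcomp Require Import all_classical all_reals all_analysis.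

Set Implicit Arguments.
Unset Strict Implicit.
Unset Printing Implicit Defensive.

Import Order.TTheory GRing.Theory Num.Theory.

Local Open Scope classical_set_scope.
Local Open Scope ring_scope.

(** Vectors of R^n are row vectors. [lpnorm a v] is meant for [1 <= a]; real
    powers of nonnegative reals are [powR], for which [0 `^ b = 0] if
    [b != 0]. *)
Definition lpnorm (R : realType) (n : nat) (a : R) (v : 'rV[R]_n) : R :=
  (\sum_(i < n) `|v ord0 i| `^ a) `^ a^-1.

Definition dotprod (R : realType) (n : nat) (y c : 'rV[R]_n) : R :=
  \sum_(i < n) y ord0 i * c ord0 i.

Definition lpball (R : realType) (n : nat) (p r : R) : set 'rV[R]_n :=
  [set y | lpnorm p y <= r].

(** The set of all minimizers of [f] over [A]; "x = arg min" is rendered as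
    [argmin A f = [set x]], i.e. [x] is the unique minimizer. *)
Definition argmin (R : realType) (T : Type) (A : set T) (f : T -> R) : set T :=
  [set x | A x /\ forall y, A y -> f x <= f y].

(* Main.v *)
(** The inequality [- y.c <= r * ||c||_q] on the ball is the sum over
    coordinates of Young's inequality for [y_i / r] and [c_i / ||c||_q].
    Young's inequality is an equality exactly when
    [y_i / r = - sgn (c_i) |c_i / ||c||_q| ^ (q - 1)], that is [y_i = x_i], which
    gives both the optimality of [x] and its uniqueness. *)

Require Import Defs.
From mathcomp Require Import all_boot all_order all_algebra.
From mathcomp Require Import all_classical all_reals all_analysis.
From mathcomp Require Import ring lra.

Import Order.TTheory GRing.Theory Num.Theory.

Local Open Scope classical_set_scope.
Local Open Scope ring_scope.

Lemma conjugate_exponentsM {R : realType} {p q : R} :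
  0 < p -> 0 < q -> p^-1 + q^-1 = 1 -> (p - 1) * (q - 1) = 1.
Proof.
move=> p0 q0 pq.
have : p * q * (p^-1 + q^-1) = p * q by rewrite pq mulr1.
have -> : p * q * (p^-1 + q^-1) = q + p by field; rewrite !gt_eqF.
lra.
Qed.

(* Dividing by [expR (a + b)] and putting [t := (q - 1) * b - a], the claim
   becomes [1 <= expR (- (p - 1) * t) / p + expR t / q], which is a convex
   combination of two instances of [1 + t <= expR t]. *)
Lemma leif_conjugate_expR {R : realType} {p q : R} (a b : R) :
  0 < p -> 0 < q -> p^-1 + q^-1 = 1 ->
  expR (a + b) <= expR (p * a) / p + expR (q * b) / q ?= iff (a == (q - 1) * b).
Proof.
move=> p0 q0 pq; set t := (q - 1) * b - a.
have pq1 := conjugate_exponentsM p0 q0 pq.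
have -> : p * a = a + b + - (p - 1) * t.
  have -> : - (p - 1) * t = (p - 1) * a - (p - 1) * (q - 1) * b by rewrite /t; ring.
  by rewrite pq1; ring.
have -> : q * b = a + b + t by rewrite /t; ring.
have tE : (a == (q - 1) * b) = (t == 0) by rewrite /t subr_eq0 eq_sym.
rewrite tE; clearbody t.
rewrite !(expRD (a + b)) -!mulrA -mulrDr -[X in X <= _ ?= iff _]mulr1.
have zero : (1 + - (p - 1) * t) / p + (1 + t) / q = 1.
  have -> : (1 + - (p - 1) * t) / p + (1 + t) / q
      = (p^-1 + q^-1) + t * (p^-1 + q^-1 - 1) by field; rewrite !gt_eqF.
  by rewrite pq subrr mulr0 addr0.
apply/leifP; have [->|t0] := eqVneq t 0.
  by rewrite mulr0 expR0 !mul1r pq mulr1.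
rewrite ltr_pM2l ?mulr_gt0 ?expR_gt0// -[X in X < _]zero.
(* Strictness of [1 + t < expR t] for [t != 0] in the second term alone makes the sum strict, which
   settles the equality case. *)
by apply: ler_ltD; rewrite ?ler_pM2r ?ltr_pM2r ?invr_gt0 ?expR_ge1Dx ?expR_gt1Dx.
Qed.

(** For positive [a] and [b] this is the exponential form at [ln a] and [ln b]; injectivity of [ln]
    carries the equality case over. *)
Lemma leif_conjugate_powR {R : realType} {p q a b : R} :
  0 <= a -> 0 <= b -> 1 < p -> 1 < q -> p^-1 + q^-1 = 1 ->
  a * b <= a `^ p / p + b `^ q / q ?= iff (a == b `^ (q - 1)).
Proof.
move=> a0 b0 p1 q1 pq.
have p0 : 0 < p by lra.
have q0 : 0 < q by lra.
have [->|bN0] := eqVneq b 0.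
  rewrite (powR0 (lt0r_neq0 q0)) powR0 ?subr_eq0 ?(gt_eqF q1)// mulr0 mul0r addr0.
  split; first by rewrite divr_ge0 ?powR_ge0 ?ltW.
  by rewrite eq_sym mulf_eq0 invr_eq0 powR_eq0 !(gt_eqF p0) /= andbT orbF.
have bgt0 : 0 < b by rewrite lt_neqAle eq_sym bN0.
have [->|aN0] := eqVneq a 0.
  apply/leifP; rewrite (powR0 (lt0r_neq0 p0)) !mul0r add0r eq_sym powR_eq0 (negPf bN0).
  by rewrite divr_gt0 ?powR_gt0.
have agt0 : 0 < a by rewrite lt_neqAle eq_sym aN0.
have := leif_conjugate_expR (ln a) (ln b) p0 q0 pq.
rewrite expRD !lnK ?posrE// -(ln_powR b (q - 1)) (inj_in_eq (@ln_inj R)) ?posrE ?powR_gt0//.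
by rewrite /powR (negPf aN0) (negPf bN0).
Qed.

(** Moving the sign of [v] onto [u] turns the left side into [w * |v|] with [|w| = |u|], so the
    nonnegative case applies to [|w|] and [|v|]. *)
Lemma leif_conjugate_signed {R : realType} {p q : R} (u v : R) :
  1 < p -> 1 < q -> p^-1 + q^-1 = 1 ->
  - (u * v) <= `|u| `^ p / p + `|v| `^ q / q
    ?= iff (u == - (Num.sg v * `|v| `^ (q - 1))).
Proof.
move=> p1 q1 pq.
have [->|vN0] := eqVneq v 0.
  have := leif_conjugate_powR (normr_ge0 u) (lexx 0) p1 q1 pq.
  rewrite sgr0 normr0 !(mulr0, mul0r) oppr0.
  by rewrite [X in _ == X]powR0 ?subr_eq0 ?(gt_eqF q1)// normr_eq0.
pose w := - (Num.sg v * u).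
have sv2 : Num.sg v * Num.sg v = 1 by rewrite -expr2 sqr_sg vN0.
have uw : `|u| = `|w| by rewrite /w normrN normrM normr_sg vN0 mul1r.
have -> : - (u * v) = w * `|v| by rewrite {1}(numEsg v) /w; ring.
have -> : (u == - (Num.sg v * `|v| `^ (q - 1))) = (w == `|v| `^ (q - 1)).
  have -> : u = - (Num.sg v * w) by rewrite /w mulrN opprK mulrA sv2 mul1r.
  rewrite eqr_opp; apply/eqP/eqP => [|-> //].
  by apply: mulfI; rewrite sgr_eq0.
rewrite uw; have Y := leif_conjugate_powR (normr_ge0 w) (normr_ge0 v) p1 q1 pq.
have [w0|w0] := leP 0 w; first by move: Y; rewrite ger0_norm.
(* A negative [w] cannot equal a power, and the inequality is then strict: [w * |v| < |w| * |v|]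
   since [v != 0]. *)
apply/leifP; rewrite lt_eqF ?(lt_le_trans w0) ?powR_ge0//.
apply: lt_le_trans Y.1; rewrite ltr_pM2r ?normr_gt0//.
by rewrite (lt_le_trans w0).
Qed.

Lemma powR_le1 {R : realType} {a x : R} :
  0 < a -> 0 <= x -> (x `^ a <= 1) = (x <= 1).
Proof.
move=> a0 x0; have := le_mono_in (gt0_ltr_powR a0) x0 ler01.
by rewrite powR1.
Qed.

Lemma lpnorm_gt0 {R : realType} {n : nat} (a : R) (v : 'rV[R]_n) :
  v != 0 -> 0 < lpnorm a v.
Proof.
move=> v0; have [i vi0] : exists i, v ord0 i != 0.
  by apply/rV0Pn.
apply: powR_gt0; rewrite (bigD1 i)//= ltr_wpDr//.
  by apply: sumr_ge0 => j _; rewrite powR_ge0.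
by rewrite powR_gt0// normr_gt0.
Qed.

Lemma sum_powR_lpnorm {R : realType} {n : nat} {a : R} (v : 'rV[R]_n) :
  a != 0 -> \sum_(i < n) `|v ord0 i| `^ a = lpnorm a v `^ a.
Proof.
move=> a0; rewrite /lpnorm -powRrM mulVf// powRr1//.
by apply: sumr_ge0 => i _; rewrite powR_ge0.
Qed.

Lemma sum_powR_div {R : realType} {n : nat} {a s : R} (v : 'rV[R]_n) :
  a != 0 -> 0 < s ->
  \sum_(i < n) `|v ord0 i / s| `^ a = (lpnorm a v / s) `^ a.
Proof.
move=> a0 s0; rewrite powRM ?powR_ge0 ?invr_ge0 ?(ltW s0)//.
rewrite -sum_powR_lpnorm// mulr_suml; apply: eq_bigr => i _.
by rewrite normrM powRM// normfV (gtr0_norm s0).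
Qed.

Lemma dotprod_scale {R : realType} {n : nat} {r s : R} (y c : 'rV[R]_n) :
  r != 0 -> s != 0 ->
  dotprod y c = r * s * \sum_(i < n) y ord0 i / r * (c ord0 i / s).
Proof.
move=> r0 s0; rewrite /dotprod mulr_sumr; apply: eq_bigr => i _.
by field; rewrite r0 s0.
Qed.

Theorem lemma5 (R : realType) (n : nat) (p q r : R) (c x : 'rV[R]_n)
  (hp : 1 < p <= 2) (hr : 0 < r) (hpq : 1 / q + 1 / p = 1) (hc : c != 0)
  (hx : forall i : 'I_n,
     x ord0 i = - (r / lpnorm q c `^ (q - 1)) * Num.sg (c ord0 i)
                * `|c ord0 i| `^ (q - 1)) :
  argmin (lpball p r) (fun y : 'rV[R]_n => dotprod y c) = [set x].
Proof.
have p1 : 1 < p by case/andP: hp.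
have p0 : 0 < p by lra.
have pq : p^-1 + q^-1 = 1 by move: hpq; rewrite !div1r addrC.
have q0 : 0 < q.
  by rewrite -invr_gt0; have : p^-1 < 1 by [rewrite invf_lt1]; lra.
have q1 : 1 < q.
  by rewrite -invf_lt1//; have : 0 < p^-1 by [rewrite invr_gt0]; lra.
set N := lpnorm q c.
have N0 : 0 < N by exact: lpnorm_gt0.
pose z i := - (Num.sg (c ord0 i / N) * `|c ord0 i / N| `^ (q - 1)).
have xz i : x ord0 i / r = z i.
  rewrite hx /z -/N sgrM normrM sgrV (gtr0_sg N0) normfV (gtr0_norm N0).
  rewrite powRM ?invr_ge0 ?(ltW N0)// mulr1.
  (* Writing [N^-1] as a power lets the exponents [-1] and [q - 1] be exchanged. *)
  rewrite -[N^-1]powR_inv1 ?(ltW N0)// powRAC powR_inv1 ?powR_ge0//.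
  by field; rewrite (lt0r_neq0 hr) (lt0r_neq0 (powR_gt0 _ N0)).
have sumc : \sum_(i < n) `|c ord0 i / N| `^ q = 1.
  by rewrite sum_powR_div ?gt_eqF// divff ?gt_eqF// powR1.
pose S (y : 'rV[R]_n) := \sum_(i < n) y ord0 i / r * (c ord0 i / N).
pose P (y : 'rV[R]_n) := \sum_(i < n) `|y ord0 i / r| `^ p.
have SE y : dotprod y c = r * N * S y by apply: dotprod_scale; rewrite gt_eqF.
have ballE y : lpball p r y = (P y <= 1) :> Prop.
  rewrite /P sum_powR_div ?gt_eqF// /lpball /=.
  have L0 : 0 <= lpnorm p y / r by rewrite divr_ge0 ?powR_ge0 ?ltW.
  by rewrite powR_le1// ler_pdivrMr// mul1r.
have young y : - S y <= P y / p + q^-1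
    ?= iff [forall i, y ord0 i / r == z i].
  (* The constant [q^-1] is the sum of the terms in [c], by [sumc]. A sum of inequalities is tight
     only if each one is. *)
  rewrite /S /P -sumrN -[q^-1]mul1r -sumc !mulr_suml -big_split /=.
  by apply: leif_sum => i _; exact: leif_conjugate_signed.
have Px : P x = 1.
  rewrite /P -sumc; apply: eq_bigr => i _; rewrite xz /z normrN normrM normr_sg.
  have [->|v0] := eqVneq (c ord0 i / N) 0.
    by rewrite normr0 mul0r !powR0 ?gt_eqF.
  (* The exponents agree: [(p - 1) * (q - 1) = 1] amounts to [(q - 1) * p = q]. Hence [x] lies on
     the sphere. *)
  rewrite mul1r ger0_norm ?powR_ge0// -powRrM; congr (_ `^ _).
  have := conjugate_exponentsM p0 q0 pq; lra.
have Sx : - S x = 1.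
  have /eqP -> : - S x == P x / p + q^-1.
    by rewrite (young x).2; apply/forallP => i; rewrite xz.
  by rewrite Px mul1r.
have ub y : lpball p r y -> P y / p + q^-1 <= 1.
  rewrite ballE => Py.
  by rewrite -pq lerD2r ler_piMl ?invr_ge0 ?(ltW p0).
apply/seteqP; split => [y [yB ymin]|_ ->] /=.
  have := ymin x; rewrite ballE Px => /(_ (lexx _)).
  rewrite !SE ler_pM2l ?mulr_gt0// -lerN2 Sx => Sy.
  (* The chain [1 <= - S y <= P y / p + q^-1 <= 1] collapses, so Young's inequality is tight at
     every coordinate of [y]. *)
  have : - S y == P y / p + q^-1.
    rewrite eq_le (young y).1 /= (le_trans _ Sy)//.
    exact: ub.
  rewrite (young y).2 => /forallP yz; apply/rowP => i.
  have /eqP := yz i; rewrite -xz; apply: mulIf.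
  by rewrite invr_eq0 gt_eqF.
split; first by rewrite ballE Px.
move=> y /ub yB; rewrite !SE ler_pM2l ?mulr_gt0//.
by rewrite -lerN2 Sx (le_trans (young y).1).
Qed.
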